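(* Let $d\in\{2,3\}$ and let $f$ be an energy density satisfying the Energy Density Assumption on the interval $I$ (see context). Let $\Gamma^m$, $H^m\in\mathbb K^m$ and $\tau_m>0$ be given, and suppose that $$(\boldsymbol X^{m+1},\mu^{m+1},H^{m+1},r^{m+1})\in[\mathbb K^m]^d\times(\mathbb K^m)^3$$ satisfies, for all $\varphi,\psi,\zeta\in\mathbb K^m$ and all $\boldsymbol\omega\in[\mathbb K^m]^d$, $$\Big(\tfrac{\delta\boldsymbol X^{m+1}}{\tau_m}\cdot\boldsymbol n^{m+\frac12},\varphi\Big)^h_{\Gamma^m}=-(\mu^{m+1}-\lambda^{m+1},\varphi)^h_{\Gamma^m},\qquad \lambda^{m+1}=\frac{(\mu^{m+1},1)^h_{\Gamma^m}}{(1,1)^h_{\Gamma^m}},$$ $$(\mu^{m+1}\boldsymbol n^{m+\frac12},\boldsymbol\omega)^h_{\Gamma^m}=\mathcal D^k_m(\boldsymbol X^{m+1},\boldsymbol\omega;H^{m+1})+\mathcal B_m(\boldsymbol\omega,r^{m+1}),$$ $$(\delta H^{m+1},\psi)^h_{\Gamma^m}=\mathcal B_m(\delta\boldsymbol X^{m+1},\psi),$$ $$(r^{m+1},\zeta)^h_{\Gamma^m}=(f_H(\boldsymbol n^m,H^{m+1}),\zeta)^h_{\Gamma^m},$$ where the stabilizing function $k\ge0$ satisfies $k(\boldsymbol n^m_j,H^{m+1}_{j_\ell})\ge k_0(\boldsymbol n^m_j,H^{m+1}_{j_\ell})$ for $1\le j\le J$, $1\le\ell\le d$. Assume that all elements $\sigma^m_j$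 of $\Gamma^m$ and $\sigma^{m+1}_j$ of $\Gamma^{m+1}$ are nondegenerate and that all nodal curvature values $H^m_i,H^{m+1}_i$ lie in $I$. Then $$V^{m+1}=V^m,\qquad W^{m+1}+\tau_m\|\mu^{m+1}-\lambda^{m+1}\|^2_{m,h}\le W^m .$$
   Context: **Density.** $d\in\{2,3\}$, $I\subseteq\mathbb R$ is an interval, $f:\mathbb S^{d-1}\times\mathbb R\to\mathbb R_{>0}$; $f_H$ is the derivative of $f$ in its second argument, and $\boldsymbol a(\boldsymbol n,s)=\nabla_{\mathbb S^{d-1}}f(\boldsymbol n,s)$ is the spherical (tangential) gradient in the first argument with $s$ fixed. *Energy Density Assumption on $I$:* for every $s\in I$, $f(\cdot,s)$ is positive and in $C^2(\mathbb S^{d-1})$, and $(5-d)f(\boldsymbol n,s)-f(-\boldsymbol n,s)\ge 0$ for all $(\boldsymbol n,s)\in\mathbb S^{d-1}\times I$; and for each $\boldsymbol n\in\mathbb S^{d-1}$, $s\mapsto f(\boldsymbol n,s)$ is continuously differentiable and convex on $I$. **Surface energy matrix.** With $\boldsymbol\xi(\boldsymbol n,s)=f(\boldsymbol n,s)\boldsymbol n+\boldsymbol a(\boldsymbol n,s)$ and a stabilizing function $k:\mathbb S^{d-1}\times I\to[0,\infty)$, $$\boldsymbol Z_k(\boldsymbol n,s)=f(\boldsymbol n,s)I_d-\boldsymbol n\boldsymbol\xi^T-\boldsymbol\xi\boldsymbol n^T+k(\boldsymbol n,s)\boldsymbol n\boldsymbol n^T .$$ **Discrete surfaces.** An oriented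 $(d-1)$-simplex $\sigma=[\boldsymbol q_1,\dots,\boldsymbol q_d]\subset\mathbb R^d$ (segment for $d=2$, triangle for $d=3$) has orientation vector $\mathcal J\{\sigma\}=(\boldsymbol q_2-\boldsymbol q_1)^\perp$ for $d=2$, where $(v_1,v_2)^\perp=(v_2,-v_1)$, and $\mathcal J\{\sigma\}=(\boldsymbol q_2-\boldsymbol q_1)\times(\boldsymbol q_3-\boldsymbol q_1)$ for $d=3$; its measure is $|\sigma|=|\mathcal J\{\sigma\}|/(d-1)$ and its unit normal is $\mathcal J\{\sigma\}/|\mathcal J\{\sigma\}|$. Nondegenerate means $|\sigma|>0$. $\Gamma^m=\bigcup_{j=1}^J\overline{\sigma^m_j}$, $\sigma^m_j=[\boldsymbol q^m_{j_1},\dots,\boldsymbol q^m_{j_d}]$, is a closed polygonal curve ($d=2$) or closed triangulated surface ($d=3$) with vertex orderings consistent with the outward orientation; $\boldsymbol n^m$ is the piecewise constant normal with value $\boldsymbol n^m_j$ on $\sigma^m_j$. $\mathbb K^m$ is the space of continuous functions on $\Gamma^m$ that are affine on each element. For $u$ affine on a simplex, $\nabla_{\Gamma^m}u$ is its constant tangential gradient; for vector fields $(\nabla_{\Gamma^m}\boldsymbol w)$ has rows $(\nabla_{\Gamma^m}w_i)^T$. $\boldsymbol X^m=\mathrm{id}$ on $\Gamma^m$. $\boldsymbol X^{m+1}\in[\mathbb K^m]^d$ maps each vertex $\boldsymbol q^m_i$ to $\boldsymbol q^{m+1}_i$, and $\Gamma^{m+1}$ has the same connectivity, with elements $\sigma_j^{m+1}=[\boldsymbol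 q^{m+1}_{j_1},\dots,\boldsymbol q^{m+1}_{j_d}]$ and normals $\boldsymbol n_j^{m+1}$. $\delta\boldsymbol X^{m+1}=\boldsymbol X^{m+1}-\boldsymbol X^m$, $\delta H^{m+1}=H^{m+1}-H^m$. Nodal values $H^{m+1}_i$ are carried to the corresponding vertices of $\Gamma^{m+1}$; $H_{j_\ell}$ is the nodal value at the $\ell$th vertex of element $j$. **Time-averaged normal.** On $\sigma^m_j$, $$\boldsymbol n^{m+\frac12}\big|_{\sigma^m_j}=\frac{\mathcal J\{\sigma^m_j\}+4\mathcal J\{\sigma^{m+\frac12}_j\}+\mathcal J\{\sigma^{m+1}_j\}}{6|\mathcal J\{\sigma^m_j\}|},\qquad \sigma^{m+\frac12}_j=\Big[\tfrac{\boldsymbol q^m_{j_1}+\boldsymbol q^{m+1}_{j_1}}2,\dots,\tfrac{\boldsymbol q^m_{j_d}+\boldsymbol q^{m+1}_{j_d}}2\Big].$$ **Quadrature.** For piecewise continuous $u,v$ with $u_{j\ell}$ the limit of $u$ at $\boldsymbol q^m_{j_\ell}$ from inside $\sigma^m_j$, $$(u,v)^h_{\Gamma^m}=\frac1d\sum_{j=1}^J\sum_{\ell=1}^d|\sigma^m_j|\,u_{j\ell}v_{j\ell},\qquad \|u\|^2_{m,h}=(u,u)^h_{\Gamma^m},$$ with the dot product for vectors; $\langle\cdot,\cdot\rangle^h_{\Gamma^m}$ is the same with the Frobenius product $U:V=\mathrm{tr}(U^TV)$ for matrices. Nonlinear coefficients are evaluated at traces, e.g. $f_H(\boldsymbol n^m,H^{m+1})_{j\ell}=f_H(\boldsymbol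 n^m_j,H^{m+1}_{j_\ell})$, and likewise for $\boldsymbol Z_k$. **Forms.** At vertex $i$ let $\mathcal T^m_i$ be the indices of incident elements and $\boldsymbol N^m_i=\sum_{j\in\mathcal T^m_i}|\sigma^m_j|\boldsymbol n^m_j\big/\big|\sum_{j\in\mathcal T^m_i}|\sigma^m_j|\boldsymbol n^m_j\big|$ (denominator assumed nonzero), and let $\boldsymbol N^m\in[\mathbb K^m]^d$ interpolate these values. On each element, $\boldsymbol P^m=I_d-\boldsymbol n^m(\boldsymbol n^m)^T$ and $\boldsymbol A^m=\boldsymbol P^m\,\tfrac12\big(\nabla_{\Gamma^m}\boldsymbol N^m+(\nabla_{\Gamma^m}\boldsymbol N^m)^T\big)\boldsymbol P^m$. Define $$\mathcal B_m(\boldsymbol w,\psi)=\langle\boldsymbol n^m(\nabla_{\Gamma^m}\psi)^T-\psi\boldsymbol A^m,\nabla_{\Gamma^m}\boldsymbol w\rangle^h_{\Gamma^m},$$ $$\mathcal D^k_m(\boldsymbol Y,\boldsymbol\omega;H)=\langle\boldsymbol Z_k(\boldsymbol n^m,H)\nabla_{\Gamma^m}\boldsymbol Y,\nabla_{\Gamma^m}\boldsymbol\omega\rangle^h_{\Gamma^m}.$$ **Threshold $k_0$.** $k_0:\mathbb S^{d-1}\times I\to[0,\infty)$ is a threshold function with the following property (such a finite $k_0$ exists for densities satisfying the Assumption): for every $s\in I$, every oriented nondegenerate $(d-1)$-simplex $\sigma$ with normal $\boldsymbol n$, every affine map $\boldsymbol X$ of $\sigma$ onto a nondegenerate simplex $\bar\sigma$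 preserving the vertex ordering, with induced normal $\bar{\boldsymbol n}$, and every value $k(\boldsymbol n,s)\ge k_0(\boldsymbol n,s)$, $$|\sigma|\,\big(\boldsymbol Z_k(\boldsymbol n,s)\nabla_\sigma\boldsymbol X\big):\big(\nabla_\sigma\boldsymbol X-\nabla_\sigma\mathrm{id}\big)\ge|\bar\sigma|f(\bar{\boldsymbol n},s)-|\sigma|f(\boldsymbol n,s),$$ where $\nabla_\sigma$ is the tangential Jacobian on $\sigma$ (so $\nabla_\sigma\mathrm{id}=I_d-\boldsymbol n\boldsymbol n^T$). **Discrete energy and volume.** $W^m=\frac1d\sum_{j=1}^J|\sigma^m_j|\sum_{\ell=1}^d f(\boldsymbol n^m_j,H^m_{j_\ell})$ and $V^m=\frac1{d^2}\sum_{j=1}^J|\sigma^m_j|\sum_{\ell=1}^d\boldsymbol q^m_{j_\ell}\cdot\boldsymbol n^m_j$ (oriented enclosed area or volume); $W^{m+1},V^{m+1}$ are the same expressions with $m+1$ in place of $m$ throughout. *)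

(* Defs.v *)
(* Throughout, the space dimension is d = p.+1 and p = d - 1 is the dimension
   of the simplices, so d \in {2, 3} reads p \in {1, 2}.  Vectors of R^d are
   column vectors.  The norm that the library puts on matrices is the max norm
   (it gives the usual topology); Euclidean lengths are written [enorm]. *)
From HB Require Import structures.
From mathcomp Require Import all_boot all_order all_algebra.
From mathcomp Require Import all_classical all_reals all_analysis.

Set Implicit Arguments.
Unset Strict Implicit.
Unset Printing Implicit Defensive.

Import Order.TTheory GRing.Theory Num.Theory.
Import numFieldNormedType.Exports.
Local Open Scope classical_set_scope.
Local Open Scope ring_scope.

Definition edot (R : realType) d (u v : 'cV[R]_d) : R :=
  \sum_(i < d) u i 0 * v i 0.

Definition enorm (R : realType) d (u : 'cV[R]_d) : R := Num.sqrt (edot u u).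

Definition usphere (R : realType) d : set 'cV[R]_d := [set n | enorm n = 1].

Definition frob (R : realType) d (U V : 'M[R]_d) : R := \tr (U^T *m V).

(* A function on the sphere is given as a function on R^d whose values off the
   sphere are irrelevant.  Regularity on the sphere and the spherical gradient
   are those of the extension x |-> g (x / |x|), which is constant along rays;
   hence its gradient at a point of the sphere is tangential. *)

Definition radial (R : realType) p (g : 'cV[R]_p.+1 -> R) : 'cV[R]_p.+1 -> R :=
  fun x => g ((enorm x)^-1 *: x).

Definition partial (R : realType) p (i : 'I_p.+1) (F : 'cV[R]_p.+1 -> R)
    (x : 'cV[R]_p.+1) : R :=
  'D_(delta_mx i 0) F x.

Definition C1_on (R : realType) p (U : set 'cV[R]_p.+1)
    (F : 'cV[R]_p.+1 -> R) : Prop :=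
  forall (i : 'I_p.+1) x, U x ->
    derivable F x (delta_mx i 0) /\ {for x, continuous (partial i F)}.

Definition C2_on (R : realType) p (U : set 'cV[R]_p.+1)
    (F : 'cV[R]_p.+1 -> R) : Prop :=
  C1_on U F /\ forall i, C1_on U (partial i F).

Definition C2_sphere (R : realType) p (g : 'cV[R]_p.+1 -> R) : Prop :=
  C2_on [set x | x != 0] (radial g).

Definition sphere_grad (R : realType) p (g : 'cV[R]_p.+1 -> R)
    (n : 'cV[R]_p.+1) : 'cV[R]_p.+1 :=
  \col_i partial i (radial g) n.

(* [fH] is the derivative of [f] in its second argument.  It is taken relative
   to [I], that is, one-sided at the end points that belong to [I]. *)
Record energy_density (R : realType) p (I : interval R)
    (f fH : 'cV[R]_p.+1 -> R -> R) : Prop := EnergyDensity {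
  ed_gt0 : forall n s, usphere n -> s \in I -> 0 < f n s;
  ed_C2 : forall s, s \in I -> C2_sphere (f^~ s);
  ed_sym : forall n s, usphere n -> s \in I ->
    0 <= (5 - p.+1%:R) * f n s - f (- n) s;
  ed_deriv : forall n s, usphere n -> s \in I ->
    (f n t - f n s) / (t - s) @[t --> within [set` I] s^'] --> fH n s;
  ed_deriv_cont : forall n, usphere n -> {within [set` I], continuous (fH n)};
  ed_convex : forall n, usphere n ->
    convex_function ([set` I] : set (convex_lmodType R^o)) (f n)
}.

Definition xi (R : realType) p (f : 'cV[R]_p.+1 -> R -> R)
    (n : 'cV[R]_p.+1) (s : R) : 'cV[R]_p.+1 :=
  f n s *: n + sphere_grad (f^~ s) n.

(* [kv] stands for the value k(n, s) of the stabilizing function. *)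
Definition Zmx (R : realType) p (f : 'cV[R]_p.+1 -> R -> R) (kv : R)
    (n : 'cV[R]_p.+1) (s : R) : 'M[R]_p.+1 :=
  (f n s)%:M - n *m (xi f n s)^T - xi f n s *m n^T + kv *: (n *m n^T).

Definition convhull (R : realType) d n (q : 'I_n -> 'cV[R]_d)
    (A : {set 'I_n}) : set 'cV[R]_d :=
  [set x | exists c : 'I_n -> R,
    [/\ forall i, 0 <= c i, \sum_(i in A) c i = 1
      & x = \sum_(i in A) c i *: q i]].

Definition simplex (R : realType) p (sg : 'I_p.+1 -> 'cV[R]_p.+1) :
    set 'cV[R]_p.+1 :=
  convhull sg [set: 'I_p.+1]%SET.

Definition relint (R : realType) p (sg : 'I_p.+1 -> 'cV[R]_p.+1) :
    set 'cV[R]_p.+1 :=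
  [set x | exists c : 'I_p.+1 -> R,
    [/\ forall l, 0 < c l, \sum_l c l = 1 & x = \sum_l c l *: sg l]].

(* (v_1, v_2) |-> (v_2, - v_1), with ordS the cyclic successor of indices;
   meaningful for p = 1 only *)
Definition perp (R : realType) p (v : 'cV[R]_p.+1) : 'cV[R]_p.+1 :=
  \col_i (if i == ord0 then v (ordS i) 0 else - v (ordS i) 0).

(* vector product; meaningful for p = 2 only *)
Definition cross (R : realType) p (u v : 'cV[R]_p.+1) : 'cV[R]_p.+1 :=
  \col_i (u (ordS i) 0 * v (ordS (ordS i)) 0
          - u (ordS (ordS i)) 0 * v (ordS i) 0).

Definition orient (R : realType) p (sg : 'I_p.+1 -> 'cV[R]_p.+1) :
    'cV[R]_p.+1 :=
  let q1 := sg ord0 in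
  let q2 := sg (ordS ord0) in
  let q3 := sg (ordS (ordS ord0)) in
  if p == 1%N then perp (q2 - q1) else cross (q2 - q1) (q3 - q1).

Definition meas (R : realType) p (sg : 'I_p.+1 -> 'cV[R]_p.+1) : R :=
  enorm (orient sg) / p%:R.

Definition nondegen (R : realType) p (sg : 'I_p.+1 -> 'cV[R]_p.+1) : Prop :=
  0 < meas sg.

Definition normal (R : realType) p (sg : 'I_p.+1 -> 'cV[R]_p.+1) :
    'cV[R]_p.+1 :=
  (enorm (orient sg))^-1 *: orient sg.

Definition affine_on (R : realType) p (sg : 'I_p.+1 -> 'cV[R]_p.+1)
    (u : 'cV[R]_p.+1 -> R) : Prop :=
  forall c : 'I_p.+1 -> R, (forall l, 0 <= c l) -> \sum_l c l = 1 ->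
    u (\sum_l c l *: sg l) = \sum_l c l * u (sg l).

Definition vcomp (R : realType) d (w : 'cV[R]_d -> 'cV[R]_d) (i : 'I_d) :
    'cV[R]_d -> R :=
  fun x => w x i 0.

(* For u affine on a nondegenerate simplex there is exactly one such g. *)
Definition tgrad (R : realType) p (sg : 'I_p.+1 -> 'cV[R]_p.+1)
    (u : 'cV[R]_p.+1 -> R) : 'cV[R]_p.+1 :=
  xget 0 [set g | edot g (normal sg) = 0 /\
    forall x y, simplex sg x -> simplex sg y -> u x - u y = edot g (x - y)].

Definition tjac (R : realType) p (sg : 'I_p.+1 -> 'cV[R]_p.+1)
    (w : 'cV[R]_p.+1 -> 'cV[R]_p.+1) : 'M[R]_p.+1 :=
  \matrix_(i, j) tgrad sg (vcomp w i) j 0.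

Record threshold (R : realType) p (I : interval R)
    (f k0 : 'cV[R]_p.+1 -> R -> R) : Prop := Threshold {
  th_ge0 : forall n s, usphere n -> s \in I -> 0 <= k0 n s;
  th_ineq : forall s (sg : 'I_p.+1 -> 'cV[R]_p.+1)
      (X : 'cV[R]_p.+1 -> 'cV[R]_p.+1) (kv : R),
    s \in I -> nondegen sg ->
    (forall i, affine_on sg (vcomp X i)) -> nondegen (X \o sg) ->
    k0 (normal sg) s <= kv ->
    meas (X \o sg) * f (normal (X \o sg)) s - meas sg * f (normal sg) s
    <= meas sg * frob (Zmx f kv (normal sg) s *m tjac sg X)
                      (tjac sg X - tjac sg idfun)
}.

(* A mesh is given by the positions [q] of its vertices and by the
   connectivity [e]: [e j l] is the index of the l-th vertex of element j. *)

Definition elt (R : realType) p nV J (q : 'I_nV -> 'cV[R]_p.+1)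
    (e : 'I_J -> 'I_p.+1 -> 'I_nV) (j : 'I_J) : 'I_p.+1 -> 'cV[R]_p.+1 :=
  fun l => q (e j l).

Definition everts p nV J (e : 'I_J -> 'I_p.+1 -> 'I_nV) (j : 'I_J) :
    {set 'I_nV} :=
  [set e j l | l : 'I_p.+1]%SET.

Definition surf (R : realType) p nV J (q : 'I_nV -> 'cV[R]_p.+1)
    (e : 'I_J -> 'I_p.+1 -> 'I_nV) : set 'cV[R]_p.+1 :=
  [set x | exists j, simplex (elt q e j) x].

(* Every face of codimension one of an element (an end point if p = 1, an edge
   if p = 2) belongs to exactly one other element, which induces the opposite
   orientation on it. *)
Definition closed_coherent p nV J (e : 'I_J -> 'I_p.+1 -> 'I_nV) : Prop :=
  if p == 1%N then
    forall j, (exists! k, e k ord0 = e j (ordS ord0)) /\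
              (exists! k, e k (ordS ord0) = e j ord0)
  else
    forall j l, exists! kl : 'I_J * 'I_p.+1,
      e kl.1 kl.2 = e j (ordS l) /\ e kl.1 (ordS kl.2) = e j l.

(* No pinched vertex: the elements around a vertex are chained through common
   faces of codimension one, which have p vertices. *)
Definition vertex_manifold p nV J (e : 'I_J -> 'I_p.+1 -> 'I_nV) : Prop :=
  forall (i : 'I_nV) (j k : 'I_J), i \in everts e j -> i \in everts e k ->
    connect [rel a b | [&& i \in everts e a, i \in everts e b
                         & #|everts e a :&: everts e b|%SET == p]] j k.

Definition outward (R : realType) p nV J (q : 'I_nV -> 'cV[R]_p.+1)
    (e : 'I_J -> 'I_p.+1 -> 'I_nV) : Prop :=
  exists Om : set 'cV[R]_p.+1,
    [/\ open Om, bounded_set Om, closure Om `\` Om = surf q e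
      & forall j x, relint (elt q e j) x ->
          \forall t \near 0^'+,
            Om (x - t *: normal (elt q e j)) /\
            ~ Om (x + t *: normal (elt q e j))].

Record closed_surface (R : realType) p nV J (q : 'I_nV -> 'cV[R]_p.+1)
    (e : 'I_J -> 'I_p.+1 -> 'I_nV) : Prop := ClosedSurface {
  cs_conforming : forall j k,
    simplex (elt q e j) `&` simplex (elt q e k)
    `<=` convhull q (everts e j :&: everts e k)%SET;
  cs_closed : closed_coherent e;
  cs_manifold : vertex_manifold e;
  cs_outward : outward q e
}.

(* Elements of K^m and [K^m]^d are functions on R^d of which only the values on
   the surface matter. *)

Definition Kspace (R : realType) p nV J (q : 'I_nV -> 'cV[R]_p.+1)
    (e : 'I_J -> 'I_p.+1 -> 'I_nV) (u : 'cV[R]_p.+1 -> R) : Prop :=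
  {within surf q e, continuous u} /\ forall j, affine_on (elt q e j) u.

Definition KspaceV (R : realType) p nV J (q : 'I_nV -> 'cV[R]_p.+1)
    (e : 'I_J -> 'I_p.+1 -> 'I_nV) (w : 'cV[R]_p.+1 -> 'cV[R]_p.+1) : Prop :=
  forall i, Kspace q e (vcomp w i).

(* (1/d) sum_j sum_l |sigma_j| g_{jl}, for a family g of one-sided values at
   the vertices of the elements; the arguments of [ips], [ipv], [ipm] are such
   families, and [trace] gives the one of a function on the surface. *)
Definition quad (R : realType) p nV J (q : 'I_nV -> 'cV[R]_p.+1)
    (e : 'I_J -> 'I_p.+1 -> 'I_nV) (g : 'I_J -> 'I_p.+1 -> R) : R :=
  (p.+1%:R)^-1 * \sum_j \sum_l meas (elt q e j) * g j l.

Definition trace (R : realType) p nV J (q : 'I_nV -> 'cV[R]_p.+1)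
    (e : 'I_J -> 'I_p.+1 -> 'I_nV) (T : Type) (u : 'cV[R]_p.+1 -> T) :
    'I_J -> 'I_p.+1 -> T :=
  fun j l => u (elt q e j l).

Definition ips (R : realType) p nV J (q : 'I_nV -> 'cV[R]_p.+1)
    (e : 'I_J -> 'I_p.+1 -> 'I_nV) (u v : 'I_J -> 'I_p.+1 -> R) : R :=
  quad q e (fun j l => u j l * v j l).

Definition ipv (R : realType) p nV J (q : 'I_nV -> 'cV[R]_p.+1)
    (e : 'I_J -> 'I_p.+1 -> 'I_nV) (u v : 'I_J -> 'I_p.+1 -> 'cV[R]_p.+1) : R :=
  quad q e (fun j l => edot (u j l) (v j l)).

Definition ipm (R : realType) p nV J (q : 'I_nV -> 'cV[R]_p.+1)
    (e : 'I_J -> 'I_p.+1 -> 'I_nV) (U V : 'I_J -> 'I_p.+1 -> 'M[R]_p.+1) : R :=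
  quad q e (fun j l => frob (U j l) (V j l)).

(* [q'] are the positions of the vertices at the new time level. *)
Definition nhalf (R : realType) p nV J (q q' : 'I_nV -> 'cV[R]_p.+1)
    (e : 'I_J -> 'I_p.+1 -> 'I_nV) (j : 'I_J) : 'cV[R]_p.+1 :=
  let qh := fun i => 2^-1 *: (q i + q' i) in
  (6 * enorm (orient (elt q e j)))^-1 *:
  (orient (elt q e j) + 4 *: orient (elt qh e j) + orient (elt q' e j)).

Definition wnormal (R : realType) p nV J (q : 'I_nV -> 'cV[R]_p.+1)
    (e : 'I_J -> 'I_p.+1 -> 'I_nV) (i : 'I_nV) : 'cV[R]_p.+1 :=
  \sum_(j | i \in everts e j) meas (elt q e j) *: normal (elt q e j).

Definition is_vertex_normal (R : realType) p nV J (q : 'I_nV -> 'cV[R]_p.+1)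
    (e : 'I_J -> 'I_p.+1 -> 'I_nV) (N : 'cV[R]_p.+1 -> 'cV[R]_p.+1) : Prop :=
  KspaceV q e N /\
  forall i, N (q i) = (enorm (wnormal q e i))^-1 *: wnormal q e i.

Definition Amx (R : realType) p nV J (q : 'I_nV -> 'cV[R]_p.+1)
    (e : 'I_J -> 'I_p.+1 -> 'I_nV) (N : 'cV[R]_p.+1 -> 'cV[R]_p.+1)
    (j : 'I_J) : 'M[R]_p.+1 :=
  let n := normal (elt q e j) in
  let P := 1%:M - n *m n^T in
  let DN := tjac (elt q e j) N in
  P *m (2^-1 *: (DN + DN^T)) *m P.

Definition Bform (R : realType) p nV J (q : 'I_nV -> 'cV[R]_p.+1)
    (e : 'I_J -> 'I_p.+1 -> 'I_nV) (N : 'cV[R]_p.+1 -> 'cV[R]_p.+1)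
    (w : 'cV[R]_p.+1 -> 'cV[R]_p.+1) (psi : 'cV[R]_p.+1 -> R) : R :=
  ipm q e
    (fun j l => normal (elt q e j) *m (tgrad (elt q e j) psi)^T
                - trace q e psi j l *: Amx q e N j)
    (fun j _ => tjac (elt q e j) w).

Definition Dform (R : realType) p nV J (q : 'I_nV -> 'cV[R]_p.+1)
    (e : 'I_J -> 'I_p.+1 -> 'I_nV) (f k : 'cV[R]_p.+1 -> R -> R)
    (Y w : 'cV[R]_p.+1 -> 'cV[R]_p.+1) (H : 'cV[R]_p.+1 -> R) : R :=
  ipm q e
    (fun j l => let n := normal (elt q e j) in
                let s := trace q e H j l in
                Zmx f (k n s) n s *m tjac (elt q e j) Y)
    (fun j _ => tjac (elt q e j) w).

(* [h] lists the nodal values of the curvature. *)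
Definition energy (R : realType) p nV J (f : 'cV[R]_p.+1 -> R -> R)
    (q : 'I_nV -> 'cV[R]_p.+1) (e : 'I_J -> 'I_p.+1 -> 'I_nV)
    (h : 'I_nV -> R) : R :=
  (p.+1%:R)^-1 *
  \sum_j meas (elt q e j) * \sum_l f (normal (elt q e j)) (h (e j l)).

Definition volume (R : realType) p nV J (q : 'I_nV -> 'cV[R]_p.+1)
    (e : 'I_J -> 'I_p.+1 -> 'I_nV) : R :=
  (p.+1%:R ^+ 2)^-1 *
  \sum_j meas (elt q e j) * \sum_l edot (q (e j l)) (normal (elt q e j)).

(* Main.v *)
Require Import Defs.
From HB Require Import structures.
From mathcomp Require Import all_boot all_order all_algebra.
From mathcomp Require Import all_classical all_reals all_analysis.
From mathcomp Require Import ring lra.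

Set Implicit Arguments.
Unset Strict Implicit.
Unset Printing Implicit Defensive.

Import Order.TTheory GRing.Theory Num.Theory.
Import numFieldNormedType.Exports.
Local Open Scope classical_set_scope.
Local Open Scope ring_scope.

(** Both conclusions come from testing the scheme with its own unknowns.  Write
    w = X - id for the displacement and m for the deviation [mu - lam] of the
    potential from its mean.

    Testing the first equation with an arbitrary phi shows that the flux of w
    through the time-averaged normals, tested with phi, equals -tau (m, phi).
    With phi = 1 it vanishes, because m has zero mean ([ips_mean0]); with
    phi = mu it equals -tau |m|^2, because m is orthogonal to constants.

    Volume.  The enclosed volume is a polynomial of degree d = p + 1 in the
    positions of the vertices.  Along the linear motion of the vertices its time
    derivative has degree p <= 2, which Simpson's rule, hence the time-averaged
    normal, integrates exactly.  On one element, the flux of w differs from the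
    increment of the volume by terms attached to its faces; these cancel over a
    closed coherently oriented surface ([closed_curve_sum0],
    [closed_surface_sum0]).  So the flux tested with 1 is exactly the increment
    of the volume ([volume_increment]), which is therefore zero.

    Energy.  Testing the second equation with w, the third with r and the fourth
    with the increment of H eliminates the form B, and leaves the flux tested
    with mu equal to D(X, w) + (f_H, H1 - H0).  This sum bounds the
    increment of the energy from above ([energy_increment]): element by element
    and vertex by vertex, the property of the threshold function controls the
    change of the surface at fixed curvature H1, and convexity of f in its
    second argument ([convex_tangent]) controls the change of the curvature at
    fixed surface.  The property of the threshold involves the Jacobian of X
    minus that of the identity, the form D the Jacobian of w; that the two agree
    rests on the linearity of the tangential gradient on affine functions
    ([tgrad_affine], [tjacB]). *)

(** * Euclidean product and cyclic indices *)

Lemma edotC (R : realType) d (u v : 'cV[R]_d) : edot u v = edot v u.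
Proof. by apply: eq_bigr => i _; rewrite mulrC. Qed.

Lemma edotDr (R : realType) d (u v w : 'cV[R]_d) :
  edot u (v + w) = edot u v + edot u w.
Proof. by rewrite -big_split; apply: eq_bigr => i _; rewrite mxE mulrDr. Qed.

Lemma edotZr (R : realType) d a (u v : 'cV[R]_d) :
  edot u (a *: v) = a * edot u v.
Proof. by rewrite big_distrr; apply: eq_bigr => i _; rewrite mxE mulrCA. Qed.

Lemma edotBr (R : realType) d (u v w : 'cV[R]_d) :
  edot u (v - w) = edot u v - edot u w.
Proof. by rewrite -scaleN1r edotDr edotZr mulN1r. Qed.

Lemma edotZl (R : realType) d a (u v : 'cV[R]_d) :
  edot (a *: u) v = a * edot u v.
Proof. by rewrite edotC edotZr edotC. Qed.

Lemma edot_sumr (R : realType) d n (u : 'cV[R]_d) (F : 'I_n -> 'cV[R]_d) :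
  edot u (\sum_i F i) = \sum_i edot u (F i).
Proof.
rewrite /edot exchange_big /=; apply: eq_bigr => j _.
by rewrite summxE big_distrr.
Qed.

Lemma edot_ge0 (R : realType) d (u : 'cV[R]_d) : 0 <= edot u u.
Proof. by apply: sumr_ge0 => i _; rewrite -expr2 sqr_ge0. Qed.

Lemma enorm_ge0 (R : realType) d (u : 'cV[R]_d) : 0 <= enorm u.
Proof. exact: sqrtr_ge0. Qed.

Lemma sum_ord2 (V : nmodType) (F : 'I_2 -> V) :
  \sum_i F i = F ord0 + F (ordS ord0).
Proof.
rewrite !big_ord_recl big_ord0 addr0; congr (_ + F _).
exact: val_inj.
Qed.

Lemma sum_ord3 (V : nmodType) (F : 'I_3 -> V) :
  \sum_i F i = F ord0 + F (ordS ord0) + F (ordS (ordS ord0)).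
Proof.
rewrite !big_ord_recl big_ord0 addr0 addrA.
by congr (_ + F _ + F _); exact: val_inj.
Qed.

Lemma ordS2 (i : 'I_2) : ordS (ordS i) = i.
Proof. by apply: val_inj; case: i => [[|[]]]. Qed.

Lemma ordS3 (i : 'I_3) : ordS (ordS (ordS i)) = i.
Proof. by apply: val_inj; case: i => [[|[|[]]]]. Qed.

(** * Nondegenerate simplices and tangential gradients *)

Lemma enorm_orient_gt0 (R : realType) p (sg : 'I_p.+1 -> 'cV[R]_p.+1) :
  nondegen sg -> 0 < enorm (orient sg).
Proof.
move=> nd; rewrite lt_def enorm_ge0 andbT; apply: contraL nd => /eqP J0.
by rewrite /nondegen /meas J0 mul0r ltxx.
Qed.

Lemma usphere_normal (R : realType) p (sg : 'I_p.+1 -> 'cV[R]_p.+1) :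
  nondegen sg -> usphere (normal sg).
Proof.
move=> nd; rewrite /usphere /normal /= {1}/enorm edotZl edotZr mulrA -invfM.
have /lt0r_neq0 J0 := enorm_orient_gt0 nd.
by rewrite -[edot _ _]sqr_sqrtr ?edot_ge0 // -/(enorm _) -expr2 mulVf
  ?sqrtr1 // expf_neq0.
Qed.

Lemma measM_normal (R : realType) p (sg : 'I_p.+1 -> 'cV[R]_p.+1) u :
  nondegen sg -> meas sg * edot u (normal sg) = edot u (orient sg) / p%:R.
Proof.
move=> nd; rewrite /meas /normal edotZr mulrACA -mulrA mulVKf ?[_ / _]mulrC //.
exact/lt0r_neq0/enorm_orient_gt0.
Qed.

(** The equations edot g (orient sg) = 0 and edot g (sg i - sg 0) = c i, which
    prescribe a tangential gradient, form a linear system for g.  The equation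
    for i = 0 would be void, so its row carries the orientation vector. *)
Definition frame (R : realType) p (sg : 'I_p.+1 -> 'cV[R]_p.+1) : 'M[R]_p.+1 :=
  \matrix_(i, j) (if i == ord0 then orient sg else sg i - sg ord0) j 0.

Lemma frame_mulmx (R : realType) p (sg : 'I_p.+1 -> 'cV[R]_p.+1) g i :
  (frame sg *m g) i 0 =
  edot g (if i == ord0 then orient sg else sg i - sg ord0).
Proof. by rewrite mxE edotC; apply: eq_bigr => j _; rewrite mxE. Qed.

Lemma det_mx2 (R : comNzRingType) (M : 'M[R]_2) :
  let i : 'I_2 := ord0 in let j := ordS i in
  \det M = M i i * M j j - M i j * M j i.
Proof.
move=> i j; rewrite (expand_det_row _ i) sum_ord2 -/i -/j.
have -> : cofactor M i i = M j j.
  rewrite /cofactor det_mx11 !mxE expr0 mul1r.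
  by congr (M _ _); exact: val_inj.
have -> : cofactor M i j = - M j i.
  rewrite /cofactor det_mx11 !mxE expr1 mulN1r.
  by congr (- M _ _); exact: val_inj.
by rewrite mulrN.
Qed.

Lemma det_mx3 (R : comNzRingType) (M : 'M[R]_3) :
  let i : 'I_3 := ord0 in let j := ordS i in let k := ordS j in
  \det M = M i i * (M j j * M k k - M j k * M k j)
         + M i j * (M j k * M k i - M j i * M k k)
         + M i k * (M j i * M k j - M j j * M k i).
Proof.
move=> i j k; rewrite (expand_det_row _ i) sum_ord3 -/i -/j -/k.
have -> : cofactor M i i = M j j * M k k - M j k * M k j.
  rewrite /cofactor det_mx2 !mxE expr0 mul1r.
  by congr (M _ _ * M _ _ - M _ _ * M _ _); exact: val_inj.
have -> : cofactor M i j = M j k * M k i - M j i * M k k.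
  rewrite /cofactor det_mx2 !mxE expr1 mulN1r opprB.
  by congr (M _ _ * M _ _ - M _ _ * M _ _); exact: val_inj.
have -> : cofactor M i k = M j i * M k j - M j j * M k i.
  rewrite /cofactor det_mx2 !mxE sqrrN expr1n mul1r.
  by congr (M _ _ * M _ _ - M _ _ * M _ _); exact: val_inj.
by [].
Qed.

(** With a and b the edges issued from the first vertex, the determinant is that
    of the rows a^perp and a in the plane, and the triple product of a x b, a
    and b in space. *)
Lemma det_frame (R : realType) p (sg : 'I_p.+1 -> 'cV[R]_p.+1) :
  p = 1%N \/ p = 2%N -> \det (frame sg) = edot (orient sg) (orient sg).
Proof.
case=> ?; subst p.
  rewrite det_mx2 /edot sum_ord2 /frame /orient /perp !mxE /= ordS2.
  ring.
rewrite det_mx3 /edot sum_ord3 /frame /orient /cross !mxE /= !ordS3.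
ring.
Qed.

Lemma frame_unit (R : realType) p (sg : 'I_p.+1 -> 'cV[R]_p.+1) :
  p = 1%N \/ p = 2%N -> nondegen sg -> frame sg \in unitmx.
Proof.
move=> hp nd; rewrite unitmxE det_frame // unitfE.
apply/negP => /eqP J0; have := enorm_orient_gt0 nd.
by rewrite /enorm J0 sqrtr0 ltxx.
Qed.

Lemma simplexP (R : realType) p (sg : 'I_p.+1 -> 'cV[R]_p.+1) x :
  simplex sg x <-> exists c : 'I_p.+1 -> R,
    [/\ forall i, 0 <= c i, \sum_i c i = 1 & x = \sum_i c i *: sg i].
Proof.
rewrite /simplex /convhull /=.
split=> -[c [c_ge0 sumc xE]]; exists c; split => //.
- by rewrite -sumc; apply: eq_bigl => i; rewrite inE.
- by rewrite xE; apply: eq_bigl => i; rewrite inE.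
- by rewrite -sumc; apply: eq_bigl => i; rewrite inE.
- by rewrite xE; apply: eq_bigl => i; rewrite inE.
Qed.

Lemma simplex_vertex (R : realType) p (sg : 'I_p.+1 -> 'cV[R]_p.+1) l :
  simplex sg (sg l).
Proof.
apply/simplexP; exists (fun i => (i == l)%:R); split => [i||].
- exact: ler0n.
- by rewrite (bigD1 l) //= eqxx big1 ?addr0 // => i /negPf ->.
- rewrite (bigD1 l) //= eqxx scale1r big1 ?addr0 // => i /negPf ->.
  by rewrite scale0r.
Qed.

(** The two conditions that define the gradient of [u] say that it solves the
    invertible system with matrix [frame sg]; its right-hand side, hence the
    gradient, is linear in [u]. *)
Lemma tgrad_affine (R : realType) p (sg : 'I_p.+1 -> 'cV[R]_p.+1) u :
  p = 1%N \/ p = 2%N -> nondegen sg -> affine_on sg u ->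
  tgrad sg u = invmx (frame sg) *m
    \col_i (if i == ord0 then 0 else u (sg i) - u (sg ord0)).
Proof.
move=> hp nd aff; set c := \col_i _.
have Fu := frame_unit hp nd.
have J_gt0 := enorm_orient_gt0 nd.
apply: xget_unique => [|g [gn gu]].
  set g := invmx _ *m c.
  have gE i : edot g (if i == ord0 then orient sg else sg i - sg ord0) = c i 0.
    by rewrite -frame_mulmx /g mulmxA mulmxV // mul1mx.
  move: g gE => g gE.
  split; first by have := gE ord0; rewrite edotZr mxE eqxx => ->; rewrite mulr0.
  have gsg i : u (sg i) - u (sg ord0) = edot g (sg i - sg ord0).
    have := gE i; rewrite mxE; case: eqP => // -> _.
    by rewrite !subrr /edot big1 // => j _; rewrite mxE mulr0.
  have gx x : simplex sg x -> u x - u (sg ord0) = edot g (x - sg ord0).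
    move=> /simplexP[a [a_ge0 suma ->]]; rewrite aff //.
    rewrite -[sg ord0 in RHS]scale1r -[u (sg ord0)]mul1r -suma.
    rewrite mulr_suml scaler_suml -!sumrB edot_sumr.
    by apply: eq_bigr => i _; rewrite -mulrBr gsg -scalerBr edotZr.
  move=> x y sx sy; have -> : x - y = (x - sg ord0) - (y - sg ord0).
    by rewrite opprB addrA subrK.
  by rewrite edotBr -!gx // opprB addrA subrK.
apply: (can_inj (mulKmx Fu)); rewrite mulmxA mulmxV // mul1mx.
apply/colP => i; rewrite frame_mulmx mxE; case: eqP => [_|_].
  apply/eqP; move/eqP: gn; rewrite edotZr mulf_eq0 invr_eq0.
  by rewrite (gt_eqF J_gt0).
by rewrite -gu //; exact: simplex_vertex.
Qed.

Lemma affine_onB (R : realType) p (sg : 'I_p.+1 -> 'cV[R]_p.+1) u v :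
  affine_on sg u -> affine_on sg v -> affine_on sg (fun x => u x - v x).
Proof.
move=> au av c c_ge0 sumc; rewrite au // av // -sumrB.
by apply: eq_bigr => i _; rewrite mulrBr.
Qed.

Lemma affine_on_id (R : realType) p (sg : 'I_p.+1 -> 'cV[R]_p.+1) i :
  affine_on sg (vcomp idfun i).
Proof.
by move=> c _ _; rewrite /vcomp /= summxE; apply: eq_bigr => j _; rewrite mxE.
Qed.

Lemma tjacB (R : realType) p (sg : 'I_p.+1 -> 'cV[R]_p.+1) X Y :
  p = 1%N \/ p = 2%N -> nondegen sg ->
  (forall i, affine_on sg (vcomp X i)) ->
  (forall i, affine_on sg (vcomp Y i)) ->
  tjac sg (fun x => X x - Y x) = tjac sg X - tjac sg Y.
Proof.
move=> hp nd aX aY; apply/matrixP => i j; rewrite !mxE.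
have -> : vcomp (fun x => X x - Y x) i = fun x => vcomp X i x - vcomp Y i x.
  by apply/funext => x; rewrite /vcomp !mxE.
rewrite !tgrad_affine //; last exact: affine_onB.
set c1 := \col_i _; set c2 := \col_i _; set c3 := \col_i _.
have -> : c1 = c2 - c3 by apply/colP => l; rewrite !mxE; case: ifP => _; ring.
by rewrite mulmxBr !mxE.
Qed.

(** * Convex functions of the curvature *)

(** A convex function lies above its tangent at [s]: along the segment from [s]
    to [t] the difference quotients stay below the slope of the chord. *)
Lemma convex_tangent (R : realType) (I : interval R) (g : R -> R) (dg s t : R) :
  convex_function ([set` I] : set (convex_lmodType R^o)) g ->
  s \in I -> t \in I ->
  (g u - g s) / (u - s) @[u --> within [set` I] s^'] --> dg ->
  dg * (t - s) <= g t - g s.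
Proof.
move=> cvx sI tI gdg.
have [->|ts] := eqVneq t s; first by rewrite !subrr mulr0.
have ts0 : t - s != 0 by rewrite subr_eq0.
have cvx_seg (th : R) : 0 <= th -> th <= 1 ->
    g (s + th * (t - s)) <= g s + th * (g t - g s).
  move=> th0 th1; have := cvx (Itv01 th0 th1) t s.
  rewrite !mem_setE => /(_ tI sI) /le_trans; rewrite convRE /=.
  have -> : s + th * (t - s) = th * t + (1 - th) * s by ring.
  by apply; rewrite /unstable.onem le_eqVlt; apply/orP/or_introl/eqP; ring.
have segI (th : R) : 0 <= th -> th <= 1 -> s + th * (t - s) \in I.
  move=> th0 th1; have sgi := @interval_is_interval R I.
  have [st|ts'] := leP s t.
    apply: (sgi s t) => //; nra.
  apply: (sgi t s) => //; nra.
have ep_gt0 ep : 0 < ep -> 0 < ep / `|t - s|.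
  by move=> ep0; rewrite divr_gt0 // normr_gt0.
have seg_cvg :
    (s + th * (t - s)) @[th --> 0^'+] --> within [set` I] s^'.
  move=> P; rewrite /= /within /= => -[ep /= ep0 sP].
  change (\forall th \near 0^'+, P (s + th * (t - s))).
  near=> th.
  have th0 : 0 < th by [].
  apply: sP => /=.
  - rewrite opprD addrA subrr add0r normrN normrM gtr0_norm //.
    rewrite -ltr_pdivlMr ?normr_gt0 //.
    by near: th; apply: nbhs_right_lt (ep_gt0 _ _).
  - by rewrite -subr_eq0 addrAC subrr add0r mulf_neq0 // gt_eqF.
  - by apply: segI; [exact: ltW|near: th; exact: nbhs_right_le].
have slope_cvg := cvg_comp _ _ seg_cvg gdg.
apply: (cvgr_to_le (cvgMr_tmp slope_cvg)).
near=> th; rewrite /= addrAC subrr add0r.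
have th0 : 0 < th by [].
rewrite invfM mulrA mulfVK // ler_pdivrMr // lerBlDl [_ * th]mulrC.
by apply: cvx_seg; [exact: ltW|near: th; exact: nbhs_right_le].
Unshelve. all: by end_near.
Qed.

(** * Volume *)

Lemma volume_orient (R : realType) p nV J (q : 'I_nV -> 'cV[R]_p.+1)
    (e : 'I_J -> 'I_p.+1 -> 'I_nV) :
  (forall j, nondegen (elt q e j)) ->
  volume q e = (p.+1%:R ^+ 2 * p%:R)^-1 *
    \sum_j \sum_l edot (q (e j l)) (orient (elt q e j)).
Proof.
move=> nd; rewrite /volume [X in _ = X * _]invfM -[RHS]mulrA; congr (_ * _).
rewrite mulr_sumr; apply: eq_bigr => j _.
rewrite !mulr_sumr; apply: eq_bigr => l _.
by rewrite measM_normal // mulrC.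
Qed.

Lemma quad_nhalf (R : realType) p nV J (q q' : 'I_nV -> 'cV[R]_p.+1)
    (e : 'I_J -> 'I_p.+1 -> 'I_nV) (w : 'I_J -> 'I_p.+1 -> 'cV[R]_p.+1) :
  (forall j, nondegen (elt q e j)) ->
  quad q e (fun j l => edot (w j l) (nhalf q q' e j)) =
  (p.+1%:R * p%:R * 6)^-1 * \sum_j \sum_l edot (w j l)
    (orient (elt q e j)
     + 4 *: orient (elt (fun i => 2^-1 *: (q i + q' i)) e j)
     + orient (elt q' e j)).
Proof.
move=> nd; rewrite /quad !invfM -!mulrA; congr (_ * _).
rewrite !mulr_sumr; apply: eq_bigr => j _.
rewrite !mulr_sumr; apply: eq_bigr => l _.
have /lt0r_neq0 a0 := enorm_orient_gt0 (nd j).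
rewrite /nhalf edotZr mulrA /meas invfM [6^-1 * _]mulrC mulrACA divff //.
by rewrite mul1r mulrA.
Qed.

(** In a closed curve every vertex is the end of one segment and the start of
    another, so that sums of differences along the segments vanish. *)
Lemma closed_curve_sum0 (V : zmodType) nV J (e : 'I_J -> 'I_2 -> 'I_nV)
    (g : 'I_nV -> V) :
  closed_coherent e -> \sum_j (g (e j (ordS ord0)) - g (e j ord0)) = 0.
Proof.
move=> cl; rewrite sumrB; apply/eqP; rewrite subr_eq0; apply/eqP.
have [nx nxP] := choice (fun j => (cl j).1).
have [pv pvP] := choice (fun j => (cl j).2).
rewrite [RHS](reindex nx) /=.
  by apply: eq_bigr => j _; rewrite (nxP j).1.
exists pv => j _.
- by apply: (pvP (nx j)).2; rewrite (nxP j).1.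
- by apply: (nxP (pv j)).2; rewrite (pvP j).1.
Qed.

(** In a coherently oriented closed surface every oriented edge is paired with
    its reversal, so that antisymmetric edge terms cancel. *)
Lemma closed_surface_sum0 (R : numDomainType) nV J (e : 'I_J -> 'I_3 -> 'I_nV)
    (G : 'I_nV -> 'I_nV -> R) :
  (forall a b, G b a = - G a b) -> closed_coherent e ->
  \sum_j \sum_l G (e j l) (e j (ordS l)) = 0.
Proof.
move=> Gskew cl; rewrite pair_big /=.
have [op opP] := choice (fun jl : 'I_J * 'I_3 => cl jl.1 jl.2).
have opK : involutive op.
  move=> [j l]; apply: (opP (op (j, l))).2.
  by rewrite (opP (j, l)).1.1 (opP (j, l)).1.2.
apply/eqP; rewrite -eqNr; apply/eqP.
rewrite [RHS](reindex_inj (inv_inj opK)) /= -sumrN.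
by apply: eq_bigr => -[j l] _; rewrite (opP (j, l)).1.1 (opP (j, l)).1.2 -Gskew.
Qed.

(** By trilinearity the derivative of a triple product (a, b, c) pairs the
    velocity of each vertex with the product of the two others, while the flux
    pairs it with the whole orientation vector a x b + b x c + c x a.  The
    surplus is a sum over oriented edges, with opposite values on an edge and on
    its reversal.  In the plane the surplus is the difference of a function of
    the vertex between the two end points. *)
Lemma volume_increment (R : realType) p nV J (q q' : 'I_nV -> 'cV[R]_p.+1)
    (e : 'I_J -> 'I_p.+1 -> 'I_nV) :
  p = 1%N \/ p = 2%N -> closed_coherent e ->
  (forall j, nondegen (elt q e j)) -> (forall j, nondegen (elt q' e j)) ->
  volume q' e - volume q e =
  quad q e (fun j l => edot (q' (e j l) - q (e j l)) (nhalf q q' e j)).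
Proof.
move=> hp cl nd nd'; rewrite !volume_orient // quad_nhalf // -mulrBr -sumrB.
case: hp => ?; subst p.
- (* [g i] is half the integral over unit time of det (velocity of i,
     position of i). *)
  pose g i := 2^-1 * (q' i ord0 0 * q i (ordS ord0) 0
                        - q' i (ordS ord0) 0 * q i ord0 0).
  rewrite -[LHS]addr0 -[X in _ + X = _](closed_curve_sum0 g cl).
  rewrite !mulr_sumr -big_split.
  apply: eq_bigr => j _ /=; rewrite !sum_ord2 /g.
  rewrite /edot !sum_ord2 /orient /perp /elt /= !mxE /= ?mxE /= !ordS2.
  by field.
- (* [G a b] is the integral over unit time, by Simpson's rule, of a sixth of
     the triple product of velocity of a plus velocity of b, position of a,
     position of b; the factor 4 of the midpoint is absorbed by the halves of
     the two midpoint positions. *)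
  pose G a b := 36^-1 * edot (q' a - q a + (q' b - q b))
    (cross (q a) (q b) + cross (q a + q' a) (q b + q' b) + cross (q' a) (q' b)).
  have Gskew a b : G b a = - G a b.
    rewrite /G /edot !sum_ord3 /cross !mxE; ring.
  rewrite -[LHS]addr0 -[X in _ + X = _](closed_surface_sum0 Gskew cl).
  rewrite !mulr_sumr -big_split.
  apply: eq_bigr => j _ /=; rewrite !sum_ord3 /G.
  rewrite /orient /elt /= ordS3.
  move: (q _) (q _) (q _) (q' _) (q' _) (q' _) => a b c a' b' c'.
  rewrite /edot !sum_ord3 /cross !mxE !ordS3.
  by field.
Qed.

(** * Test functions and quadrature *)

Lemma Kspace1 (R : realType) p nV J (q : 'I_nV -> 'cV[R]_p.+1)
    (e : 'I_J -> 'I_p.+1 -> 'I_nV) : Kspace q e (fun=> 1).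
Proof.
split => [|j c _ sumc]; first exact: cst_continuous.
by under eq_bigr do rewrite mulr1.
Qed.

Lemma KspaceB (R : realType) p nV J (q : 'I_nV -> 'cV[R]_p.+1)
    (e : 'I_J -> 'I_p.+1 -> 'I_nV) u v :
  Kspace q e u -> Kspace q e v -> Kspace q e (fun x => u x - v x).
Proof.
move=> [uc ua] [vc va]; split => [x|j]; last exact: affine_onB.
by apply: (@cvgB _ _ _ _ _ (u : subspace _ -> R) v); [exact: uc|exact: vc].
Qed.

Lemma KspaceV_id (R : realType) p nV J (q : 'I_nV -> 'cV[R]_p.+1)
    (e : 'I_J -> 'I_p.+1 -> 'I_nV) : KspaceV q e idfun.
Proof.
move=> i; split => [|j]; last exact: affine_on_id.
by apply: continuous_subspaceT => x; exact: coord_continuous.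
Qed.

Lemma KspaceVB (R : realType) p nV J (q : 'I_nV -> 'cV[R]_p.+1)
    (e : 'I_J -> 'I_p.+1 -> 'I_nV) w z :
  KspaceV q e w -> KspaceV q e z -> KspaceV q e (fun x => w x - z x).
Proof.
move=> wK zK i; have := KspaceB (wK i) (zK i); congr (Kspace q e).
by apply/funext => x; rewrite /vcomp !mxE.
Qed.

Lemma quadB (R : realType) p nV J (q : 'I_nV -> 'cV[R]_p.+1)
    (e : 'I_J -> 'I_p.+1 -> 'I_nV) g h :
  quad q e (fun j l => g j l - h j l) = quad q e g - quad q e h.
Proof.
rewrite /quad -mulrBr -sumrB; congr (_ * _); apply: eq_bigr => j _.
by rewrite -sumrB; apply: eq_bigr => l _; rewrite mulrBr.
Qed.

Lemma quadZ (R : realType) p nV J (q : 'I_nV -> 'cV[R]_p.+1)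
    (e : 'I_J -> 'I_p.+1 -> 'I_nV) a g :
  quad q e (fun j l => a * g j l) = a * quad q e g.
Proof.
rewrite /quad mulrCA; congr (_ * _); rewrite mulr_sumr; apply: eq_bigr => j _.
by rewrite mulr_sumr; apply: eq_bigr => l _; rewrite mulrCA.
Qed.

Lemma eq_quad (R : realType) p nV J (q : 'I_nV -> 'cV[R]_p.+1)
    (e : 'I_J -> 'I_p.+1 -> 'I_nV) g h :
  (forall j l, g j l = h j l) -> quad q e g = quad q e h.
Proof.
move=> gh; rewrite /quad; congr (_ * _).
by apply: eq_bigr => j _; apply: eq_bigr => l _; rewrite gh.
Qed.

(** The mean subtracted from [u] is its quadrature projection on constants. *)
Lemma ips_mean0 (R : realType) p nV J (q : 'I_nV -> 'cV[R]_p.+1)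
    (e : 'I_J -> 'I_p.+1 -> 'I_nV) (u : 'I_J -> 'I_p.+1 -> R) lam :
  (forall j, nondegen (elt q e j)) ->
  lam = ips q e u (fun _ _ => 1) / ips q e (fun _ _ => 1) (fun _ _ => 1) ->
  ips q e (fun j l => u j l - lam) (fun _ _ => 1) = 0.
Proof.
move=> nd lamE.
have -> : ips q e (fun j l => u j l - lam) (fun _ _ => 1) =
    ips q e u (fun _ _ => 1) - lam * ips q e (fun _ _ => 1) (fun _ _ => 1).
  rewrite /ips -quadZ -quadB; apply: eq_quad => j l; ring.
(* Without elements both sides are empty sums; otherwise the total measure, by
   which [lam] divides, is positive. *)
case: J e u nd lamE => [|J] e u nd lamE.
  by rewrite /ips /quad !big_ord0 !mulr0 subrr.
rewrite lamE divfK ?subrr // gt_eqF // /ips /quad mulr_gt0 //.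
rewrite big_ord_recl ltr_wpDr //.
  apply: sumr_ge0 => j _; apply: sumr_ge0 => l _.
  by rewrite !mulr1; exact/ltW/nd.
rewrite big_ord_recl ltr_wpDr //.
  by apply: sumr_ge0 => l _; rewrite !mulr1; exact/ltW/nd.
by rewrite !mulr1; exact: nd.
Qed.

(** * Energy *)

(** Insert meas * f(n, H1) on the old element between the new and the old
    energy: the surface then changes at curvature H1, and the curvature changes
    on the old surface. *)
Lemma energy_increment (R : realType) p (I : interval R)
    (f fH k0 k : 'cV[R]_p.+1 -> R -> R) nV J (q : 'I_nV -> 'cV[R]_p.+1)
    (e : 'I_J -> 'I_p.+1 -> 'I_nV) (X : 'cV[R]_p.+1 -> 'cV[R]_p.+1)
    (H0 H1 : 'cV[R]_p.+1 -> R) :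
  p = 1%N \/ p = 2%N -> energy_density I f fH -> threshold I f k0 ->
  (forall i j, affine_on (elt q e j) (vcomp X i)) ->
  (forall j l, k0 (normal (elt q e j)) (H1 (q (e j l)))
                    <= k (normal (elt q e j)) (H1 (q (e j l)))) ->
  (forall j, nondegen (elt q e j)) -> (forall j, nondegen (elt (X \o q) e j)) ->
  (forall i, H0 (q i) \in I) -> (forall i, H1 (q i) \in I) ->
  energy f (X \o q) e (H1 \o q) - energy f q e (H0 \o q) <=
  Dform q e f k X (fun x => X x - x) H1
  + ips q e (fun j l => fH (normal (elt q e j)) (trace q e H1 j l))
            (trace q e (fun x => H1 x - H0 x)).
Proof.
move=> hp hf hk0 Xa hk nd nd' hI0 hI1.
rewrite /energy /Dform /ipm /ips /quad -mulrBr -mulrDr ler_pM2l ?invr_gt0 //.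
rewrite -sumrB -big_split; apply: ler_sum => j _.
rewrite !mulr_sumr -sumrB -big_split; apply: ler_sum => l _ /=.
set s1 := H1 (q (e j l)); set s0 := H0 (q (e j l)).
have sph := usphere_normal (nd j).
have surf_le := th_ineq hk0 (hI1 (e j l)) (nd j) (Xa^~ j) (nd' j) (hk j l).
rewrite (tjacB hp (nd j) (Xa^~ j)); last by move=> i; exact: affine_on_id.
have curv_le : f (normal (elt q e j)) s1 - f (normal (elt q e j)) s0 <=
    fH (normal (elt q e j)) s1 * (s1 - s0).
  have := convex_tangent (ed_convex hf sph) (hI1 (e j l)) (hI0 (e j l))
    (ed_deriv hf sph (hI1 (e j l))).
  rewrite -/s1 -/s0; lra.
have := lerD surf_le (ler_wpM2l (ltW (nd j)) curv_le).
by rewrite -/s1 [meas (elt q e j) * (_ - _)]mulrBr addrA subrK.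
Qed.

Theorem corollary6p3 (R : realType) (p : nat) (hp : p = 1%N \/ p = 2%N)
  (I : interval R)
  (f fH : 'cV[R]_p.+1 -> R -> R)
  (f_gt0 : forall n s, usphere n -> 0 < f n s)
  (hf : energy_density I f fH)
  (k0 k : 'cV[R]_p.+1 -> R -> R)
  (hk0 : threshold I f k0)
  (k_ge0 : forall n s, usphere n -> s \in I -> 0 <= k n s)
  (nV J : nat) (q : 'I_nV -> 'cV[R]_p.+1) (e : 'I_J -> 'I_p.+1 -> 'I_nV)
  (hsurf : closed_surface q e)
  (hwn : forall i, wnormal q e i != 0)
  (N : 'cV[R]_p.+1 -> 'cV[R]_p.+1) (hN : is_vertex_normal q e N)
  (H0 : 'cV[R]_p.+1 -> R) (hH0 : Kspace q e H0)
  (tau : R) (htau : 0 < tau)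
  (X : 'cV[R]_p.+1 -> 'cV[R]_p.+1) (mu H1 r : 'cV[R]_p.+1 -> R)
  (hX : KspaceV q e X) (hmu : Kspace q e mu)
  (hH1 : Kspace q e H1) (hr : Kspace q e r)
  (lam : R)
  (hlam : lam = ips q e (trace q e mu) (fun _ _ => 1)
                / ips q e (fun _ _ => 1) (fun _ _ => 1))
  (eq_X : forall phi, Kspace q e phi ->
     ips q e (fun j l => edot (tau^-1 *: trace q e (fun x => X x - x) j l)
                              (nhalf q (X \o q) e j))
             (trace q e phi)
     = - ips q e (trace q e (fun x => mu x - lam)) (trace q e phi))
  (eq_mu : forall w, KspaceV q e w ->
     ipv q e (fun j l => trace q e mu j l *: nhalf q (X \o q) e j)
             (trace q e w)
     = Dform q e f k X w H1 + Bform q e N w r)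
  (eq_H : forall psi, Kspace q e psi ->
     ips q e (trace q e (fun x => H1 x - H0 x)) (trace q e psi)
     = Bform q e N (fun x => X x - x) psi)
  (eq_r : forall zeta, Kspace q e zeta ->
     ips q e (trace q e r) (trace q e zeta)
     = ips q e (fun j l => fH (normal (elt q e j)) (trace q e H1 j l))
               (trace q e zeta))
  (hk : forall j l, k0 (normal (elt q e j)) (H1 (q (e j l)))
                    <= k (normal (elt q e j)) (H1 (q (e j l))))
  (hnd0 : forall j, nondegen (elt q e j))
  (hnd1 : forall j, nondegen (elt (X \o q) e j))
  (hI0 : forall i, H0 (q i) \in I)
  (hI1 : forall i, H1 (q i) \in I) :
  volume (X \o q) e = volume q e /\
  energy f (X \o q) e (H1 \o q)
    + tau * ips q e (trace q e (fun x => mu x - lam))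
                    (trace q e (fun x => mu x - lam))
  <= energy f q e (H0 \o q).
Proof.
have Xa i j : affine_on (elt q e j) (vcomp X i) := (hX i).2 j.
have wK : KspaceV q e (fun x => X x - x) :=
  KspaceVB hX (@KspaceV_id _ _ _ _ q e).
have mean0 := ips_mean0 hnd0 hlam.
pose flux j l := edot (X (q (e j l)) - q (e j l)) (nhalf q (X \o q) e j).
have fluxE phi : Kspace q e phi -> ips q e flux (trace q e phi) =
    - tau * ips q e (trace q e (fun x => mu x - lam)) (trace q e phi).
  move=> phiK; rewrite mulNr -mulrN -eq_X // /ips -quadZ.
  by apply: eq_quad => j l; rewrite edotZl !mulrA divff ?mul1r // gt_eqF.
have flux_mu : ips q e flux (trace q e mu) =
    Dform q e f k X (fun x => X x - x) H1
    + ips q e (fun j l => fH (normal (elt q e j)) (trace q e H1 j l))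
              (trace q e (fun x => H1 x - H0 x)).
  rewrite -eq_r; last exact: KspaceB.
  have -> : ips q e (trace q e r) (trace q e (fun x => H1 x - H0 x)) =
      Bform q e N (fun x => X x - x) r.
    by rewrite -eq_H //; apply: eq_quad => j l; rewrite mulrC.
  rewrite -eq_mu //; apply: eq_quad => j l.
  by rewrite edotZl mulrC [in RHS]edotC.
have norm2E : ips q e (trace q e (fun x => mu x - lam))
                      (trace q e (fun x => mu x - lam)) =
    ips q e (trace q e (fun x => mu x - lam)) (trace q e mu).
  rewrite -[RHS]subr0 -[X in _ - X](mulr0 lam) -mean0 /ips -quadZ -quadB.
  by apply: eq_quad => j l; rewrite /trace; ring.
split.
  apply/eqP; rewrite -subr_eq0.
  rewrite (volume_increment hp (cs_closed hsurf) hnd0 hnd1).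
  have := fluxE _ (@Kspace1 _ _ _ _ q e).
  rewrite [X in _ = _ * X]mean0 mulr0 => <-.
  by apply/eqP/eq_quad => j l; rewrite /trace mulr1.
have := energy_increment hp hf hk0 Xa hk hnd0 hnd1 hI0 hI1.
rewrite -flux_mu fluxE // norm2E; lra.
Qed.
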